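(* Let $\mathcal{H}$ be a complex Hilbert space and let $A,B\in \mathcal{B}(\mathcal{H})$. Put $$\nu=\frac{c^2(\Re(A))+c^2(\Im(A))}{2}+\left|\frac{\|\Re(A)\|^2-\|\Im(A)\|^2}{2}+\frac{c^2(\Im(A))-c^2(\Re(A))}{2}\right|.$$ Then, for either choice of the sign $\pm$, $$w(AB\pm BA)\leq 2\sqrt{2}\,\|B\|\sqrt{w^2(A)-\nu}.$$
   Context: $\mathcal{B}(\mathcal{H})$ denotes the algebra of all bounded linear operators on the complex Hilbert space $\mathcal{H}$, with operator norm $\|\cdot\|$ and adjoint $A^*$. The numerical radius is $w(A)=\sup\{|\langle Ax,x\rangle| : x\in\mathcal{H},\ \|x\|=1\}$ and the Crawford number is $c(A)=\inf\{|\langle Ax,x\rangle| : x\in\mathcal{H},\ \|x\|=1\}$; $w^2(\cdot)$ and $c^2(\cdot)$ denote their squares. The real and imaginary parts are the operators $\Re(A)=\frac{A+A^*}{2}$ and $\Im(A)=\frac{A-A^*}{2\mathrm{i}}$. *)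

(* Defs.v *)
From HB Require Import structures.
From mathcomp Require Import all_boot all_order all_algebra.
From mathcomp Require Import sesquilinear complex.
From mathcomp Require Import all_classical all_reals all_analysis.

Set Implicit Arguments.
Unset Strict Implicit.
Unset Printing Implicit Defensive.

Import Order.TTheory GRing.Theory Num.Theory.
Import numFieldNormedType.Exports.

Local Open Scope classical_set_scope.
Local Open Scope ring_scope.
Local Open Scope complex_scope.

(* The inner product is linear in its first argument and conjugate-linear in
   its second one. The norm of H takes its values in R[i], as for every normed
   module over R[i]. *)
HB.mixin Record CompleteNormedModule_isHilbert (R : realType) (H : Type)
    of CompleteNormedModule R[i] H := {
  inner : {dot H for (@Num.conj R[i])} ;
  sqr_norm_inner : forall x : H, `|x| ^+ 2 = inner x x
}.

#[short(type="hilbertType")]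
HB.structure Definition Hilbert (R : realType) :=
  {H of CompleteNormedModule R[i] H & CompleteNormedModule_isHilbert R H}.

Section Operators.
Context {R : realType} {H : hilbertType R}.
Implicit Types A : H -> H.

Definition is_adjoint A (A' : H -> H) : Prop :=
  forall x y, inner (A x) y = inner x (A' y).

(* A bounded operator on a Hilbert space has exactly one adjoint (Riesz); the
   default value 0 is only reached by functions that have none. *)
Definition adjoint A : H -> H := xget (fun=> 0) [set A' | is_adjoint A A'].

Definition re_op A : H -> H := fun x => 2^-1 *: (A x + adjoint A x).

Definition im_op A : H -> H := fun x => (2 * 'i)^-1 *: (A x - adjoint A x).

(* The quantities below are elements of R: for z : R[i], both `|z| and the norm
   of H are real elements of R[i], and complex.Re recovers the element of R. *)
Definition op_norm A : R :=
  sup [set complex.Re `|A x| | x in [set x : H | `|x| <= 1]].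

Definition numerical_radius A : R :=
  sup [set complex.Re `|inner (A x) x| | x in [set x : H | `|x| = 1]].

Definition crawford A : R :=
  inf [set complex.Re `|inner (A x) x| | x in [set x : H | `|x| = 1]].

Definition nu A : R :=
  (crawford (re_op A) ^+ 2 + crawford (im_op A) ^+ 2) / 2
  + `| (op_norm (re_op A) ^+ 2 - op_norm (im_op A) ^+ 2) / 2
       + (crawford (im_op A) ^+ 2 - crawford (re_op A) ^+ 2) / 2 |.

End Operators.

(* Main.v *)
(* Write A = P + iQ with P and Q self-adjoint. For a unit vector x,
   |<(AB +- BA)x, x>| <= ||B|| (||A^* x|| + ||Ax||), and the parallelogram law
   bounds this by 2 ||B|| sqrt (||Px||^2 + ||Qx||^2). On the other hand
   |<Ax, x>|^2 = <Px, x>^2 + <Qx, x>^2, and the norm of a self-adjoint operator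
   is its numerical radius, so w(A)^2 >= ||P||^2 + c(Q)^2 and
   w(A)^2 >= ||Q||^2 + c(P)^2. The larger of these two lower bounds is
   (||P||^2 + ||Q||^2) / 2 + nu. *)
Require Import Defs.
From HB Require Import structures.
From mathcomp Require Import all_boot all_order all_algebra.
From mathcomp Require Import sesquilinear complex.
From mathcomp Require Import all_classical all_reals all_analysis.
From mathcomp Require Import ring lra.

Set Implicit Arguments.
Unset Strict Implicit.
Unset Printing Implicit Defensive.

Import Order.TTheory GRing.Theory Num.Theory.
Import numFieldNormedType.Exports.

Local Open Scope classical_set_scope.
Local Open Scope ring_scope.
Local Open Scope complex_scope.

(** * Real-valued norms *)

Section RealNorm.
Context {R : realType}.

(** Moving norms from [R[i]] to the ordered field [R] gives [lra], [nra] and suprema access to them.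
    Scalars are seen in [R[i]^o], so that the modulus is an instance too. *)
Definition normr_re (V : normedModType R[i]) (x : V) : R := complex.Re `|x|.

Lemma normr_reE (V : normedModType R[i]) (x : V) : (normr_re x)%:C = `|x|.
Proof. by apply: RRe_real; exact: normr_real. Qed.

Lemma normr_re_ge0 (V : normedModType R[i]) (x : V) : 0 <= normr_re x.
Proof. by rewrite -ler0c normr_reE. Qed.

Lemma normr_re_eq0 (V : normedModType R[i]) (x : V) :
  (normr_re x == 0) = (x == 0).
Proof. by rewrite -(inj_eq (@complexI R)) normr_reE normr_eq0. Qed.

Lemma normr_reZ (V : normedModType R[i]) (a : R[i]) (x : V) :
  normr_re (a *: x) = normr_re (a : R[i]^o) * normr_re x.
Proof. by apply: complexI; rewrite rmorphM /= !normr_reE normrZ. Qed.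

Lemma normr_reC (a : R) : normr_re (a%:C : R[i]^o) = `|a|.
Proof. by rewrite /normr_re normc_def /= expr0n addr0 sqrtr_sqr. Qed.

Lemma ler_normr_reD (V : normedModType R[i]) (x y : V) :
  normr_re (x + y) <= normr_re x + normr_re y.
Proof. by rewrite -lecR rmorphD /= !normr_reE ler_normD. Qed.

Lemma ler_Re_normr_re (z : R[i]) : `|complex.Re z| <= normr_re (z : R[i]^o).
Proof. by rewrite -lecR normr_reE; exact: normc_ge_Re. Qed.

Lemma sqr_normr_re (z : R[i]) :
  normr_re (z : R[i]^o) ^+ 2 = complex.Re z ^+ 2 + complex.Im z ^+ 2.
Proof. by apply: complexI; rewrite rmorphXn /= normr_reE add_Re2_Im2. Qed.

End RealNorm.

(** * The underlying real inner product, and Cauchy-Schwarz *)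

Section RealDot.
Context {R : realType} {H : hilbertType R}.
Implicit Types (x y z : H) (a : R) (c : R[i]).

Definition dot_re x y : R := complex.Re (inner x y).

Lemma innerC x y : inner x y = (inner y x)^*%C.
Proof. by rewrite hermC expr0 mul1r. Qed.

Lemma innerDl x y z : inner (x + y) z = inner x z + inner y z.
Proof. exact: linearDl. Qed.

Lemma innerDr x y z : inner z (x + y) = inner z x + inner z y.
Proof. exact: linearDr. Qed.

Lemma innerBl x y z : inner (x - y) z = inner x z - inner y z.
Proof. exact: linearBl. Qed.

Lemma innerBr x y z : inner z (x - y) = inner z x - inner z y.
Proof. exact: linearBr. Qed.

Lemma innerZl c x y : inner (c *: x) y = c * inner x y.
Proof. exact: linearZl_LR. Qed.

Lemma innerZr c x y : inner x (c *: y) = (c^*)%R * inner x y.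
Proof. by rewrite linearZr_LR. Qed.

Lemma dot_reC x y : dot_re x y = dot_re y x.
Proof. by rewrite /dot_re innerC; case: (inner y x). Qed.

Lemma dot_re0l z : dot_re 0 z = 0.
Proof. by rewrite /dot_re linear0l. Qed.

Lemma dot_reDl x y z : dot_re (x + y) z = dot_re x z + dot_re y z.
Proof. by rewrite /dot_re linearDl raddfD. Qed.

Lemma dot_reNl x z : dot_re (- x) z = - dot_re x z.
Proof. by rewrite /dot_re linearNl raddfN. Qed.

Lemma dot_reZl a x y : dot_re (a%:C *: x) y = a * dot_re x y.
Proof. by rewrite /dot_re innerZl; case: (inner x y) => u v /=; ring. Qed.

Lemma dot_reDr x y z : dot_re z (x + y) = dot_re z x + dot_re z y.
Proof. by rewrite !(dot_reC z) dot_reDl. Qed.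

Lemma dot_reNr x z : dot_re z (- x) = - dot_re z x.
Proof. by rewrite !(dot_reC z) dot_reNl. Qed.

Lemma dot_reZr a x y : dot_re x (a%:C *: y) = a * dot_re x y.
Proof. by rewrite !(dot_reC x) dot_reZl. Qed.

Lemma dot_rexx x : dot_re x x = normr_re x ^+ 2.
Proof.
by apply: complexI; rewrite rmorphXn /= normr_reE sqr_norm_inner /dot_re
  RRe_real // ger0_real // -sqr_norm_inner exprn_ge0.
Qed.

Lemma parallelogram x y :
  normr_re (x + y) ^+ 2 + normr_re (x - y) ^+ 2
  = 2 * (normr_re x ^+ 2 + normr_re y ^+ 2).
Proof.
rewrite -!dot_rexx !dot_reDl !dot_reDr !dot_reNl !dot_reNr; ring.
Qed.

Lemma ler_dot_re x y : dot_re x y <= normr_re x * normr_re y.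
Proof.
have [->|y0] := eqVneq y 0.
  by rewrite dot_reC dot_re0l mulr_ge0 ?normr_re_ge0.
have Ny : 0 < normr_re y by rewrite lt_def normr_re_eq0 y0 normr_re_ge0.
(* The square expands to [2 |x| |y| (|x| |y| - dot_re x y)], which is to be divided by [|x| |y|];
   hence the separate case of a null [x]. *)
have := sqr_ge0 (normr_re ((normr_re y)%:C *: x - (normr_re x)%:C *: y)).
rewrite -dot_rexx !(dot_reDl, dot_reDr, dot_reNl, dot_reNr, dot_reZl, dot_reZr).
rewrite !dot_rexx (dot_reC y x).
have := normr_re_ge0 x; rewrite le_eqVlt => /orP[/eqP Nx|Nx].
  move: (Nx) => /esym/eqP; rewrite normr_re_eq0 => /eqP ->.
  by rewrite dot_re0l mulr_ge0 ?normr_re_ge0.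
move=> h; rewrite -(ler_pM2l (mulr_gt0 Nx Ny)); nra.
Qed.

(** Multiplying [x] by the conjugate of [c = inner x y] makes the inner product equal to the real
    number [|c|^2]. The real inequality then reads [|c|^2 <= |c| |x| |y|]. *)
Lemma cauchy_schwarz x y :
  normr_re (inner x y : R[i]^o) <= normr_re x * normr_re y.
Proof.
have := normr_re_ge0 (inner x y : R[i]^o).
rewrite le_eqVlt => /orP[/eqP <-|c0]; first by rewrite mulr_ge0 ?normr_re_ge0.
have := ler_dot_re ((inner x y)^*%C *: x) y.
rewrite normr_reZ {1}/dot_re innerZl mulrC -sqr_normc.
have -> : normr_re ((inner x y)^*%C : R[i]^o) = normr_re (inner x y : R[i]^o).
  by rewrite /normr_re normcJ.
rewrite -[`|inner x y|](@normr_reE R (R[i]^o)) -rmorphXn /=.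
by rewrite expr2 -mulrA ler_pM2l.
Qed.

End RealDot.

(** * Riesz representation and existence of adjoints *)

Section Riesz.
Context {R : realType} {H : hilbertType R}.

Lemma riesz_approx (g : H -> R) (M : R) :
    {morph g : x y / x + y} -> (forall a x, g (a%:C *: x) = a * g x) ->
    (forall x, g x <= M * normr_re x) ->
  forall e, 0 < e ->
    exists x, forall h, `|dot_re h x - g h| <= e * normr_re h.
Proof.
move=> gD gZ gM e e0.
(* g is represented by the minimizer of J, and approximately represented by
   the near-minimizers. *)
pose J x := normr_re x ^+ 2 - 2 * g x.
have JD x h t : J (x + t%:C *: h)
    = J x + (t ^+ 2 * normr_re h ^+ 2 + 2 * t * (dot_re h x - g h)).
  rewrite /J -!dot_rexx !(dot_reDl, dot_reDr, dot_reZl, dot_reZr) gD gZ.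
  by rewrite (dot_reC x h); ring.
have Jinf : has_inf (range J).
  split; first by exists (J 0), 0.
  (* Here [J x >= |x|^2 - 2 M |x| = (|x| - M)^2 - M^2]. *)
  exists (- M ^+ 2) => _ [x _ <-]; rewrite /J.
  have := gM x; have := sqr_ge0 (normr_re x - M); nra.
(* A tolerance of [e ^+ 2] on [J] is what yields an error linear in [e]: the quadratic in [t] below
   stays above [- e ^+ 2], and its minimum is [- d ^+ 2 / |h|^2], reached at [t = - d / |h|^2]. *)
have [_ [x _ <-] Jx] := inf_adherent (exprn_gt0 2 e0) Jinf.
exists x => h; set d := _ - _.
have Jt t : - e ^+ 2 <= t ^+ 2 * normr_re h ^+ 2 + 2 * t * d.
  have := ge_inf (proj2 Jinf) (imageT J (x + t%:C *: h)).
  by rewrite JD -/d; lra.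
have [h0|h0] := eqVneq h 0.
  have g0 : g 0 = 0 by have := gZ 0 0; rewrite scaler0 mul0r.
  by rewrite /d h0 dot_re0l g0 subr0 normr0 mulr_ge0 ?normr_re_ge0 ?ltW.
have Nh : 0 < normr_re h by rewrite lt_def normr_re_eq0 h0 normr_re_ge0.
rewrite -ler_sqr ?nnegrE ?normr_ge0 ?mulr_ge0 ?normr_re_ge0 ?(ltW e0) //.
rewrite real_normK ?num_real // exprMn.
have N2 : 0 < normr_re h ^+ 2 by rewrite exprn_gt0.
have tE : (- d / normr_re h ^+ 2) ^+ 2 * normr_re h ^+ 2
    + 2 * (- d / normr_re h ^+ 2) * d = - d ^+ 2 / normr_re h ^+ 2.
  by field; rewrite lt0r_neq0.
have := Jt (- d / normr_re h ^+ 2).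
rewrite tE ler_pdivlMr //; lra.
Qed.

(** The sets [S e] of vectors representing [g] up to [e] are nonempty and nested, so they generate a
    proper filter. It is Cauchy, and its limit, given by completeness, represents [g] exactly. *)
Lemma riesz_re (g : H -> R) (M : R) :
    {morph g : x y / x + y} -> (forall a x, g (a%:C *: x) = a * g x) ->
    (forall x, g x <= M * normr_re x) ->
  exists z, forall h, g h = dot_re h z.
Proof.
move=> gD gZ gM.
have approx := riesz_approx gD gZ gM.
pose S e : set H := [set x | forall h, `|dot_re h x - g h| <= e * normr_re h].
pose F := filter_from [set e : R | 0 < e] S.
have FF : ProperFilter F.
  apply: filter_from_proper; last by move=> e /= /approx[x]; exists x.
  apply: filter_from_filter; first by exists 1 => /=.
  move=> e f /= e0 f0; exists (Num.min e f); first by rewrite /= lt_min e0.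
  by move=> x Sx; split=> h; apply: (le_trans (Sx h));
    rewrite ler_wpM2r ?normr_re_ge0 // ge_min lexx ?orbT.
have FS e : 0 < e -> F (S e) by move=> e0; exists e.
have cF : cauchy F.
  apply: cauchy_exP => e e0.
  have eE : (complex.Re e)%:C = e by rewrite RRe_real // gtr0_real.
  (* Two members [x], [y] of [S (e / 3)] satisfy [|x - y|^2 <= (2 / 3) e |x - y|], by testing both
     on [x - y]; this leaves the strict inequality required by the ball. *)
  have r0 : 0 < complex.Re e / 3 by rewrite divr_gt0 // -ltcR eE.
  have [x Sx] := approx _ r0.
  exists x, (complex.Re e / 3) => // y Sy.
  rewrite -ball_normE /= -normr_reE -eE ltcR.
  have := Sx (x - y); have := Sy (x - y).
  rewrite !ler_norml => /andP[a1 a2] /andP[b1 b2].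
  have : normr_re (x - y) ^+ 2 <= 2 / 3 * complex.Re e * normr_re (x - y).
    rewrite -dot_rexx [X in X <= _]dot_reDr dot_reNr; lra.
  have := normr_re_ge0 (x - y); rewrite le_eqVlt => /orP[/eqP <-|n0]; first lra.
  rewrite expr2 ler_pM2r // => ?; lra.
have /cvg_ex[/= z Fz] : cvg F by exact: cauchy_cvg cF.
exists z => h; apply/eqP; rewrite eq_sym -subr_eq0 -normr_eq0; apply/eqP.
apply/le_anti; rewrite normr_ge0 andbT; apply/ler_addgt0Pr => e e0; rewrite add0r.
have n1 : 0 < normr_re h + 1 by have := normr_re_ge0 h; lra.
(* For [x] in [S d] and within [d] of [z], the error at [h] is at most [2 d |h| <= e]. The [+ 1]
   keeps the denominator positive when [h] is null. *)
have d0 : 0 < e / 2 / (normr_re h + 1) by rewrite !divr_gt0.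
set d := e / 2 / _ in d0.
have dE : d * (normr_re h + 1) = e / 2 by rewrite /d divfK // gt_eqF.
have Fb : F (ball z d%:C) by apply: Fz; apply: nbhsx_ballx; rewrite ltcR.
have [x [Sx]] := filter_ex (filterI (FS _ d0) Fb).
rewrite -ball_normE /= -normr_reE ltcR => zx.
have := Sx h; have := ler_dot_re h (z - x); have := ler_dot_re (- h) (z - x).
rewrite !dot_reNl !dot_reDr !dot_reNr.
have -> : normr_re (- h) = normr_re h by rewrite /normr_re normrN.
have := normr_re_ge0 h.
rewrite !ler_norml => hn c1 c2 /andP[a1 a2].
have : normr_re h * normr_re (z - x) <= normr_re h * d.
  by rewrite ler_wpM2l // ltW.
by move=> ?; apply/andP; split; lra.
Qed.

Lemma riesz (f : H -> R[i]) (M : R) : scalar f ->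
    (forall x, normr_re (f x : R[i]^o) <= M * normr_re x) ->
  exists z, forall x, f x = inner x z.
Proof.
move=> fl fM.
have f0 : f 0 = 0 by have := fl (-1) 0 0; rewrite scaler0 addr0 mulN1r addNr.
have fZ c x : f (c *: x) = c * f x by have := fl c x 0; rewrite f0 !addr0.
have fD x y : f (x + y) = f x + f y by have := fl 1 x y; rewrite scale1r mul1r.
have [] := @riesz_re (fun x => complex.Re (f x)) M.
- by move=> x y; rewrite fD raddfD.
- by move=> a x; rewrite fZ; case: (f x) => u v /=; ring.
- move=> x; apply: le_trans (fM x); apply: le_trans (ler_Re_normr_re _).
  exact: ler_norm.
move=> z zP; exists z => x.
(* The real part at [i x] is minus the imaginary part at [x], so agreement of the real parts at [x]
   and [i x] gives agreement of the complex values. *)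
have := zP ('i%C *: x); have := zP x; rewrite /dot_re innerZl fZ.
by case: (f x) (inner x z) => u v [u' v'] /= -> ?; congr Complex; lra.
Qed.

(** Riesz applied to [x |-> inner (A x) y] for each [y], followed by choice, produces an adjoint;
    [xget] therefore does not fall back on its default value. *)
Lemma adjointP (A : {linear H -> H}) (M : R) :
  (forall x, normr_re (A x) <= M * normr_re x) -> is_adjoint A (adjoint A).
Proof.
move=> AM; rewrite /adjoint; case: xgetP => //= noadj; exfalso.
have rA y : exists z, forall x, inner (A x) y = inner x z.
  apply: (@riesz _ (M * normr_re y)).
    by move=> c u v; rewrite linearP linearPl.
  move=> x; apply: le_trans (cauchy_schwarz _ _) _.
  by rewrite mulrAC ler_wpM2r // normr_re_ge0.
have [A' A'P] := choice rA.
by apply: (noadj A') => x y; exact: A'P.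
Qed.

End Riesz.

(** * Operator norm, numerical radius and Crawford number *)

Section OperatorBounds.
Context {R : realType} {H : hilbertType R}.
Implicit Types (T P Q : H -> H) (x y : H).

Lemma bounded_nearP (A : {linear H -> H}) : bounded_near A (nbhs (0 : H)) ->
  exists M : R, forall x, normr_re (A x) <= M * normr_re x.
Proof.
move=> /linear_boundedP/pinfty_ex_gt0[M M0 AM]; exists (complex.Re M) => x.
by rewrite -lecR rmorphM /= !normr_reE RRe_real ?gtr0_real.
Qed.

Lemma normr_re1 x : `|x| = 1 -> normr_re x = 1.
Proof. by move=> x1; rewrite /normr_re x1. Qed.

Lemma unit_vector x : x != 0 -> `|(normr_re x)^-1%:C *: x| = 1.
Proof.
move=> x0; rewrite -normr_reE normr_reZ normr_reC ger0_norm ?invr_ge0 ?normr_re_ge0 //.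
by rewrite mulVf // normr_re_eq0.
Qed.

Lemma inner_inj x x' : (forall y, inner x y = inner x' y) -> x = x'.
Proof.
move=> xx'; apply/eqP; rewrite -subr_eq0 -(dnorm_eq0 inner).
by rewrite innerBl xx' subrr.
Qed.

Lemma is_adjointC T T' : is_adjoint T T' -> is_adjoint T' T.
Proof. by move=> TT' x y; rewrite innerC -TT' -innerC. Qed.

(** [re_op A] and [im_op A] are bare functions; this recovers their homogeneity, which [ler_op_norm]
    asks for, from self-adjointness. *)
Lemma is_adjoint_scalable T T' : is_adjoint T T' -> scalable T.
Proof.
by move=> TT' c x; apply: inner_inj => y; rewrite !(TT', innerZl).
Qed.

Lemma op_norm_ubound T (k : R) :
  (forall x, normr_re (T x) <= k * normr_re x) -> 0 <= k ->
  ubound [set complex.Re `|T x| | x in [set x : H | `|x| <= 1]] k.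
Proof.
move=> Tk k0 _ [x /= x1 <-]; apply: le_trans (Tk x) _.
by rewrite ler_piMr // -lecR normr_reE.
Qed.

Lemma ge_op_norm T (k : R) : (forall x, normr_re (T x) <= k * normr_re x) ->
  0 <= k -> op_norm T <= k.
Proof.
move=> Tk k0; apply: ge_sup; last exact: op_norm_ubound.
by exists (complex.Re `|T 0|), 0 => //=; rewrite normr0.
Qed.

Lemma ler_op_norm T (k : R) : scalable T ->
    (forall x, normr_re (T x) <= k * normr_re x) ->
  forall x, normr_re (T x) <= op_norm T * normr_re x.
Proof.
move=> TZ Tk x.
have [->|x0] := eqVneq x 0.
  by have := Tk 0; rewrite /normr_re normr0 /= !mulr0.
have Nx : 0 < normr_re x by rewrite lt_def normr_re_eq0 x0 normr_re_ge0.
have k0 : 0 <= k by rewrite -(pmulr_lge0 _ Nx) (le_trans _ (Tk x)) ?normr_re_ge0.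
have hs : has_ubound [set complex.Re `|T x| | x in [set x : H | `|x| <= 1]].
  by exists k; exact: op_norm_ubound.
have := ub_le_sup hs; rewrite -/(op_norm T).
move=> /(_ (normr_re (T ((normr_re x)^-1%:C *: x)))) Tu.
rewrite mulrC -ler_pdivrMl // -[X in X * _]ger0_norm ?invr_ge0 ?(ltW Nx) //.
rewrite -normr_reC -normr_reZ -TZ; apply: Tu.
by exists ((normr_re x)^-1%:C *: x); rewrite //= unit_vector.
Qed.

Lemma op_norm_ge0 T (k : R) : (forall x, normr_re (T x) <= k * normr_re x) ->
  0 <= k -> 0 <= op_norm T.
Proof.
move=> Tk k0; apply: le_trans (normr_re_ge0 (T 0)) _.
apply: ub_le_sup; first by exists k; exact: op_norm_ubound.
by exists 0 => //=; rewrite normr0.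
Qed.

Lemma normr_inner_le_numerical_radius T (k : R) x :
    (forall x, normr_re (T x) <= k * normr_re x) -> `|x| = 1 ->
  normr_re (inner (T x) x : R[i]^o) <= numerical_radius T.
Proof.
move=> Tk x1; apply: ub_le_sup; last by exists x.
exists k => _ [y /= y1 <-]; apply: le_trans (cauchy_schwarz _ _) _.
by have := Tk y; rewrite (normr_re1 y1) !mulr1.
Qed.

Lemma crawford_le T x : `|x| = 1 ->
  crawford T <= normr_re (inner (T x) x : R[i]^o).
Proof.
move=> x1; apply: ge_inf; last by exists x.
by exists 0 => _ [y _ <-]; exact: (normr_re_ge0 (_ : R[i]^o)).
Qed.

Lemma crawford_ge0 T : 0 <= crawford T.
Proof.
rewrite /crawford; set E := image _ _.
(* The trivial space has no unit vector, and there the infimum takes its default value 0. *)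
have [->|E0] := eqVneq E set0; first by rewrite inf0.
apply: lb_le_inf; first exact/set0P.
by move=> _ [y _ <-]; exact: (normr_re_ge0 (_ : R[i]^o)).
Qed.

(** Polarization: for self-adjoint [P], the quadratic form at [x + y] minus that at [x - y] is
    [4 * dot_re (P x) y]. Bounding both terms and applying the parallelogram law gives [polar]. *)
Lemma selfadjoint_normr_le P (k : R) : is_adjoint P P ->
    (forall x, `|x| = 1 -> normr_re (inner (P x) x : R[i]^o) <= k) ->
  forall x, normr_re (P x) <= k * normr_re x.
Proof.
move=> PP Pk x.
have dP y z : dot_re (P y) z = dot_re y (P z) by rewrite /dot_re PP.
have PZ := is_adjoint_scalable PP.
have quad y : `|dot_re (P y) y| <= k * normr_re y ^+ 2.
  have [->|y0] := eqVneq y 0.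
    by rewrite dot_reC dot_re0l normr0 -dot_rexx dot_re0l mulr0.
  have Ny : 0 < normr_re y by rewrite lt_def normr_re_eq0 y0 normr_re_ge0.
  have := le_trans (ler_Re_normr_re _) (Pk _ (unit_vector y0)).
  rewrite -/(dot_re _ _) PZ dot_reZl dot_reZr mulrA normrM -expr2.
  by rewrite (ger0_norm (sqr_ge0 _)) exprVn mulrC ler_pdivrMr ?exprn_gt0.
have polar y : 4 * dot_re (P x) y <= 2 * k * (normr_re x ^+ 2 + normr_re y ^+ 2).
  have := quad (x + y); have := quad (x - y).
  rewrite !ler_norml => /andP[q1 _] /andP[_ q2].
  have := parallelogram x y.
  move: q1 q2; rewrite !(dot_reDr, dot_reNr) !dP !(dot_reDl, dot_reNl).
  rewrite !(dot_reC _ (P _)) !dP (dot_reC y (P x)) dP => q1 q2 para.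
  have : k * normr_re (x + y) ^+ 2 + k * normr_re (x - y) ^+ 2
     = 2 * k * (normr_re x ^+ 2 + normr_re y ^+ 2) by rewrite -mulrDr para; ring.
  lra.
have [->|x0] := eqVneq x 0.
  have -> : P 0 = 0 by have := PZ 0 0; rewrite !scale0r.
  by rewrite /normr_re normr0 /= mulr0.
have Nx : 0 < normr_re x by rewrite lt_def normr_re_eq0 x0 normr_re_ge0.
have [p0|p0] := eqVneq (P x) 0.
  rewrite p0 /normr_re normr0 /= mulr_ge0 ?normr_re_ge0 //.
  exact: le_trans (normr_re_ge0 _) (Pk _ (unit_vector x0)).
have Np : 0 < normr_re (P x) by rewrite lt_def normr_re_eq0 p0 normr_re_ge0.
(* This [y] is the multiple of [P x] with the norm of [x], so [polar] becomes
   [4 |x| |P x| <= 4 k |x|^2]. *)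
have := polar ((normr_re x / normr_re (P x))%:C *: P x).
rewrite dot_reZr dot_rexx normr_reZ normr_reC ger0_norm ?divr_ge0 ?normr_re_ge0 //.
rewrite divfK ?gt_eqF // [X in 4 * X](_ : _ = normr_re x * normr_re (P x)); last first.
  by field; rewrite gt_eqF.
by move=> h; rewrite -(ler_pM2l Nx); lra.
Qed.

Lemma selfadjoint_op_norm_crawford P Q (w : R) (e : H) : `|e| = 1 ->
    is_adjoint P P ->
    (forall x, `|x| = 1 -> normr_re (inner (P x) x : R[i]^o) ^+ 2
       + normr_re (inner (Q x) x : R[i]^o) ^+ 2 <= w ^+ 2) ->
  op_norm P ^+ 2 + crawford Q ^+ 2 <= w ^+ 2
  /\ forall x, normr_re (P x) <= op_norm P * normr_re x.
Proof.
move=> e1 PP PQw.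
pose k := Num.sqrt (w ^+ 2 - crawford Q ^+ 2).
have PQ x : `|x| = 1 -> normr_re (inner (P x) x : R[i]^o) ^+ 2
    <= w ^+ 2 - crawford Q ^+ 2.
  move=> x1; have := PQw x x1; have := crawford_le Q x1; have := crawford_ge0 Q.
  move=> c0 cq; have : crawford Q ^+ 2 <= normr_re (inner (Q x) x : R[i]^o) ^+ 2.
    by rewrite ler_sqr ?nnegrE ?normr_re_ge0.
  lra.
have Pk x : normr_re (P x) <= k * normr_re x.
  apply: selfadjoint_normr_le => // y y1.
  by rewrite -[leLHS]ger0_norm ?normr_re_ge0 // -sqrtr_sqr ler_wsqrtr // PQ.
(* The unit vector [e] shows that the radicand is nonnegative; otherwise [Num.sqrt] would return
   0. *)
have k2 : k ^+ 2 = w ^+ 2 - crawford Q ^+ 2.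
  by rewrite sqr_sqrtr // (le_trans _ (PQ e e1)) // sqr_ge0.
split; last by apply: ler_op_norm => //; exact: is_adjoint_scalable PP.
rewrite -lerBrDr -k2 ler_sqr ?nnegrE ?sqrtr_ge0 ?(op_norm_ge0 Pk) ?sqrtr_ge0 //.
by apply: ge_op_norm; rewrite ?sqrtr_ge0.
Qed.

End OperatorBounds.

(** * Real and imaginary parts of an operator *)

Section CartesianDecomposition.
Context {R : realType} {H : hilbertType R}.
Context (A : H -> H) (AA : is_adjoint A (adjoint A)).

Lemma re_op_selfadjoint : is_adjoint (re_op A) (re_op A).
Proof.
move=> x y; rewrite /re_op innerZl innerZr innerDl innerDr AA.
rewrite (is_adjointC AA) addrC; congr (_ * _).
by rewrite fmorphV rmorph_nat.
Qed.

Lemma im_op_selfadjoint : is_adjoint (im_op A) (im_op A).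
Proof.
move=> x y; rewrite /im_op innerZl innerZr innerBl innerBr AA.
rewrite (is_adjointC AA) -opprB mulrN -mulNr; congr (_ * _).
by rewrite fmorphV rmorphM rmorph_nat [X in _ = (_ * X)^-1](@conjCi R[i]) mulrN invrN.
Qed.

Lemma cartesian_decomposition x : A x = re_op A x + 'i%R *: im_op A x.
Proof.
rewrite /re_op /im_op scalerA invfM mulrCA divff ?neq0Ci // mulr1 -scalerDr.
by rewrite addrACA subrr addr0 -mulr2n -[A x *+ 2]scaler_nat scalerA mulVf ?pnatr_eq0 // scale1r.
Qed.

(** This is the parallelogram law for [A x] and [adjoint A x], the factors [2^-1] and [(2 * 'i)^-1]
    both having modulus 1/2. *)
Lemma normr_re_op_im_op x :
  normr_re (A x) ^+ 2 + normr_re (adjoint A x) ^+ 2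
  = 2 * (normr_re (re_op A x) ^+ 2 + normr_re (im_op A x) ^+ 2).
Proof.
have n2 (c : R[i]) y : normr_re (c *: y) ^+ 2 = normr_re (c : R[i]^o) ^+ 2 * normr_re y ^+ 2.
  by rewrite normr_reZ exprMn.
have h2 : normr_re (2^-1 : R[i]^o) = 2^-1.
  by apply: complexI; rewrite normr_reE fmorphV rmorph_nat ger0_norm // invr_ge0 ler0n.
have hi : normr_re ((2 * 'i)^-1 : R[i]^o) = 2^-1.
  apply: complexI; rewrite normr_reE fmorphV rmorph_nat normfV normrM normCi mulr1.
  by rewrite ger0_norm.
rewrite /re_op /im_op !n2 h2 hi -mulrDr parallelogram; lra.
Qed.

(** Self-adjointness makes the two inner products on the right real, so they are the real and
    imaginary parts of the one on the left. *)
Lemma sqr_normr_inner x :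
  normr_re (inner (A x) x : R[i]^o) ^+ 2
  = normr_re (inner (re_op A x) x : R[i]^o) ^+ 2
    + normr_re (inner (im_op A x) x : R[i]^o) ^+ 2.
Proof.
have sa P : is_adjoint P P -> complex.Im (inner (P x) x) = 0.
  by move=> PP; have := innerC (P x) x; rewrite -PP; case: (inner _ _) => u v [] /=; lra.
rewrite {1}cartesian_decomposition innerDl (innerZl 'i%R) -complexiE.
rewrite !sqr_normr_re; move: (sa _ re_op_selfadjoint) (sa _ im_op_selfadjoint).
by case: (inner (re_op A x) x) (inner (im_op A x) x) => p p' [q q'] /= -> ->; ring.
Qed.

End CartesianDecomposition.

(** Keeping [T] abstract treats both signs at once: the triangle inequality is all that is asked of
    it. *)
Lemma numerical_radius_le_of_commutator (R : realType) (H : hilbertType R) (A B : {linear H -> H})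
    (T : H -> H) :
    bounded_near A (nbhs (0 : H)) -> bounded_near B (nbhs (0 : H)) ->
    (forall x, normr_re (inner (T x) x : R[i]^o)
      <= normr_re (inner (A (B x)) x : R[i]^o) + normr_re (inner (B (A x)) x : R[i]^o)) ->
  numerical_radius T
    <= 2 * Num.sqrt 2 * op_norm B * Num.sqrt (numerical_radius A ^+ 2 - nu A).
Proof.
move=> /bounded_nearP[MA AM] /bounded_nearP[MB BM] Tle.
have Bb := ler_op_norm (linearZ_LR B) BM.
have AA := adjointP AM.
have B0 : 0 <= op_norm B.
  apply: (@op_norm_ge0 _ _ _ `|MB|) => // x; apply: le_trans (BM x) _.
  by rewrite ler_wpM2r ?normr_re_ge0 ?ler_norm.
have rhs0 : 0 <= 2 * Num.sqrt 2 * op_norm B * Num.sqrt (numerical_radius A ^+ 2 - nu A).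
  by rewrite !mulr_ge0 ?sqrtr_ge0.
rewrite {1}/numerical_radius; set E := image _ _.
(* In the trivial space the supremum is 0. Otherwise the unit vector [x] introduced next also serves
   as the vector [e] of [selfadjoint_op_norm_crawford]. *)
have [->|/set0P E0] := eqVneq E set0; first by rewrite sup0.
apply: ge_sup => // _ [x /= x1 <-].
have wA y : `|y| = 1 -> normr_re (inner (re_op A y) y : R[i]^o) ^+ 2
    + normr_re (inner (im_op A y) y : R[i]^o) ^+ 2 <= numerical_radius A ^+ 2.
  move=> y1; rewrite -sqr_normr_inner //.
  have wy := normr_inner_le_numerical_radius AM y1.
  by rewrite ler_sqr ?nnegrE ?normr_re_ge0 // (le_trans _ wy) // normr_re_ge0.
have [P1 P2] := selfadjoint_op_norm_crawford x1 (re_op_selfadjoint AA) wA.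
have wA' y : `|y| = 1 -> normr_re (inner (im_op A y) y : R[i]^o) ^+ 2
    + normr_re (inner (re_op A y) y : R[i]^o) ^+ 2 <= numerical_radius A ^+ 2.
  by move=> /wA; rewrite addrC.
have [Q1 Q2] := selfadjoint_op_norm_crawford x1 (im_op_selfadjoint AA) wA'.
have PQ : op_norm (re_op A) ^+ 2 + op_norm (im_op A) ^+ 2
    <= 2 * (numerical_radius A ^+ 2 - nu A).
  (* According to the sign of [d], adding half the sum of the squared norms to [nu A] gives exactly
     the left-hand side of [P1] or of [Q1]. *)
  rewrite /nu; set d := (X in `|X|).
  by have [d0|d0] := leP 0 d; rewrite ?(ger0_norm d0) ?(ltr0_norm d0) /d; lra.
have n1 := normr_re1 x1.
have Tx : normr_re (inner (T x) x : R[i]^o)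
    <= op_norm B * (normr_re (adjoint A x) + normr_re (A x)).
  apply: le_trans (Tle x) _; rewrite mulrDr lerD //.
    (* Moving [A] to the right slot leaves [inner (B x) (adjoint A x)], so that only [B x] and
       [adjoint A x] need bounding. *)
    rewrite AA; apply: le_trans (cauchy_schwarz _ _) _.
    by rewrite ler_wpM2r ?normr_re_ge0 //; have := Bb x; rewrite n1 mulr1.
  by apply: le_trans (cauchy_schwarz _ _) _; rewrite n1 mulr1.
apply: le_trans Tx _.
rewrite [leRHS](_ : _ = op_norm B * (2 * Num.sqrt (2 * (numerical_radius A ^+ 2 - nu A)))).
  rewrite ler_wpM2l //; set s := _ + _.
  have s0 : 0 <= s by rewrite addr_ge0 ?normr_re_ge0.
  have N2 : op_norm (re_op A) ^+ 2 + op_norm (im_op A) ^+ 2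
      >= normr_re (re_op A x) ^+ 2 + normr_re (im_op A x) ^+ 2.
    rewrite lerD // ler_sqr ?nnegrE ?normr_re_ge0 //.
    - by have := P2 x; rewrite n1 mulr1.
    - by rewrite (le_trans (normr_re_ge0 (re_op A x))) //; have := P2 x; rewrite n1 mulr1.
    - by have := Q2 x; rewrite n1 mulr1.
    - by rewrite (le_trans (normr_re_ge0 (im_op A x))) //; have := Q2 x; rewrite n1 mulr1.
  (* The squared mean of [|A x|] and [|adjoint A x|] is at most the mean of their squares, which
     [normr_re_op_im_op] identifies with the left side of [N2]. *)
  have s2 : (s / 2) ^+ 2 <= 2 * (numerical_radius A ^+ 2 - nu A).
    have := normr_re_op_im_op A x.
    have := sqr_ge0 (normr_re (A x) - normr_re (adjoint A x)).
    rewrite /s; nra.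
  rewrite mulrC -ler_pdivrMr // -[leLHS]ger0_norm ?divr_ge0 //.
  by rewrite -sqrtr_sqr ler_wsqrtr.
by rewrite (sqrtrM _ (ler0n _ 2)); ring.
Qed.

Theorem corollary3p2 (R : realType) (H : hilbertType R) (A B : {linear H -> H})
    (bddA : bounded_near A (nbhs (0 : H)))
    (bddB : bounded_near B (nbhs (0 : H))) :
  numerical_radius (fun x => A (B x) + B (A x))
    <= 2 * Num.sqrt 2 * op_norm B * Num.sqrt (numerical_radius A ^+ 2 - nu A)
  /\
  numerical_radius (fun x => A (B x) - B (A x))
    <= 2 * Num.sqrt 2 * op_norm B * Num.sqrt (numerical_radius A ^+ 2 - nu A).
Proof.
split; apply: numerical_radius_le_of_commutator => // x.
  by rewrite innerDl; exact: ler_normr_reD.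
rewrite innerBl; apply: le_trans (ler_normr_reD _ _) _.
by rewrite {2}/normr_re normrN.
Qed.
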